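(* Let $q>1$ and consider the $L_q$-loss $L[(x,y),g]=|y-g(x)|^q$ with output space $\mathcal Y=\mathbb R$. Assume that $\mathcal G$ is a finite set of prediction functions with $\sup_{g\in\mathcal G,x\in\mathcal X}|g(x)|\le b$ for some $b>0$, and that $\mathbb E|Y|^s\le A$ for some $s\ge q$ and $A>0$. Let $\pi$ be the uniform distribution on $\mathcal G$, let $C_1>0$ and $$\lambda=\begin{cases}C_1\big(\frac{\log|\mathcal G|}n\big)^{(q-1)/s}&\text{when }q\le s<2q-2,\\ C_1\big(\frac{\log|\mathcal G|}n\big)^{q/(s+2)}&\text{when }s\ge2q-2.\end{cases}$$ Then the expected risk of the algorithm which draws its prediction function uniformly among $\mathbb E_{g\sim\pi_{-\lambda\Sigma_0}}g,\dots,\mathbb E_{g\sim\pi_{-\lambda\Sigma_n}}g$, i.e. $\mathbb E_{Z_1^n}\frac1{n+1}\sum_{i=0}^nR\big(\mathbb E_{g\sim\pi_{-\lambda\Sigma_i}}g\big)$, is upper bounded by $$\begin{cases}\min_{g\in\mathcal G}R(g)+C\big(\frac{\log|\mathcal G|}n\big)^{1-\frac{q-1}s}&\text{when }q\le s\le2q-2,\\ \min_{g\in\mathcal G}R(g)+C\big(\frac{\log|\mathcal G|}n\big)^{1-\frac q{s+2}}&\text{when }s\ge2q-2,\end{cases}$$ for a quantity $C$ which depends only on $C_1$, $b$, $A$, $q$ and $s$.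
   Context: $Z_1=(X_1,Y_1),\dots,Z_n=(X_n,Y_n)$ are i.i.d. from an unknown distribution $P$ on $\mathcal X\times\mathbb R$, and $(X,Y)$ denotes a generic pair with law $P$. A prediction function is a measurable map $\mathcal X\to\mathbb R$; $R(g)=\mathbb E_{(X,Y)\sim P}|Y-g(X)|^q$. $\Sigma_i(g)=\sum_{j=1}^iL(Z_j,g)$ with $\Sigma_0\equiv0$. For $h:\mathcal G\to\mathbb R$, $\pi_{-h}(dg)=\frac{e^{-h(g)}}{\mathbb E_{g'\sim\pi}e^{-h(g')}}\pi(dg)$, and $\mathbb E_{g\sim\rho}g$ denotes the function $x\mapsto\mathbb E_{g\sim\rho}g(x)$. *)

(* Defs.v *)
From HB Require Import structures.
From mathcomp Require Export all_boot all_order all_algebra finmap.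
From mathcomp Require Export all_classical all_reals all_analysis.
Export Order.TTheory GRing.Theory Num.Theory numFieldNormedType.Exports.

Set Implicit Arguments.
Unset Strict Implicit.
Unset Printing Implicit Defensive.

Local Open Scope classical_set_scope.
Local Open Scope ring_scope.

Definition mutually_independent {R : realType} {dO d : measure_display}
    {Omega : measurableType dO} {T : measurableType d}
    (Pr : probability Omega R) {I : finType} (Z : I -> {RV Pr >-> T}) : Prop :=
  forall (J : {set I}) (A : I -> set T),
    (forall i, i \in J -> measurable (A i)) ->
    Pr (\bigcap_(i in [set` J]) (Z i @^-1` A i)) =
    (\prod_(i in J) Pr (Z i @^-1` A i))%E.

Definition iid_from {R : realType} {dO d : measure_display}
    {Omega : measurableType dO} {T : measurableType d}
    (Pr : probability Omega R) {I : finType} (P : probability T R)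
    (Z : I -> {RV Pr >-> T}) : Prop :=
  mutually_independent Z /\
  forall i (A : set T), measurable A -> distribution Pr (Z i) A = P A.

Section finite_distributions.
Context {R : realType} {F : choiceType}.
Implicit Types (G : {fset F}) (rho : F -> R).

(* A distribution on the finite set G is encoded by its mass function rho, of
   which only the values on G matter; this is E_{g ~ rho} u(g). *)
Definition fmean G rho (u : F -> R) : R := \sum_(g <- G) rho g * u g.

Definition funif G : F -> R := fun=> (#|` G|%:R)^-1.

(* Mass function of pi_{-h}. *)
Definition gibbs G (pi : F -> R) (h : F -> R) : F -> R :=
  fun g => expR (- h g) / fmean G pi (fun g' => expR (- h g')) * pi g.

End finite_distributions.

Section regression.
Context {R : realType} {d : measure_display} {X : measurableType d}.
Implicit Types (G : {fset {mfun X >-> R}}) (P : probability (X * R)%type R).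

Definition Lq_loss (q : R) (z : X * R) (g : X -> R) : R :=
  `|z.2 - g z.1| `^ q.

Definition risk P (q : R) (g : X -> R) : \bar R :=
  (\int[P]_z (Lq_loss q z g)%:E)%E.

Definition aggregate G (rho : {mfun X >-> R} -> R) : X -> R :=
  fun x => fmean G rho (fun g => g x).

(* Sigma_i(g) = sum_{j=1}^i L(Z_j, g); the observation Z_j is z (j - 1). *)
Definition cumul_loss (q : R) (n : nat) (z : 'I_n -> X * R) (i : nat)
    (g : X -> R) : R :=
  \sum_(j < n | (j < i)%N) Lq_loss q (z j) g.

(* x |-> E_{g ~ pi_{-lambda Sigma_i}} g(x), with pi uniform on G. *)
Definition gibbs_aggregate G (q lambda : R) (n : nat) (z : 'I_n -> X * R)
    (i : nat) : X -> R :=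
  aggregate G (gibbs G (funif G) (fun g => lambda * cumul_loss q z i g)).

End regression.

(* The parameter lambda; r stands for log|G| / n. *)
Definition temperature {R : realType} (C1 q s r : R) : R :=
  if s < 2 * q - 2 then C1 * r `^ ((q - 1) / s) else C1 * r `^ (q / (s + 2)).

(* Main.v *)
From HB Require Import structures.
Require Import Defs.
From mathcomp Require Import measurable_realfun ring lra.

(** Let V(c) = - ln E_{g ~ pi} exp(- lambda c(g)) be the free energy of a loss vector c.
Since - ln E_{g ~ pi_{- lambda Sigma_i}} exp(- lambda L(z, g)) = V(Sigma_i + L(z, .)) - V(Sigma_i),
a pointwise bound
  lambda L(z, E_rho g) <= - ln E_{g ~ rho} exp(- lambda L(z, g)) + psi(z)
valid for every rho makes the risks telescope: as Z_{i+1} is independent of the past, the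
expectation of V(Sigma_i + L(z, .)) over an independent z ~ P is that of V(Sigma_{i+1}), so
  lambda sum_i E R(g_i) <= E V(Sigma_{n+1}) + (n+1) E psi
                        <= lambda (n+1) R(g) + ln|G| + (n+1) E psi.

For the L_q loss, write h = |y| + b.  If lambda q h^q <= q - 1 the loss is exp-concave and psi = 0
works.  In general, Jensen's inequality and a second order expansion give psi <= 2 min(M, M^2) with
M = 2 b q lambda h^(q-1), hence psi <= 2 M^k for every k in [1, 2].  With kappa = s/(q-1) when
s < 2q-2, and kappa = (s+2)/q otherwise (from k = 2 and the fact that lambda h^q is bounded below
outside of the exp-concave regime), one gets psi <= K lambda^kappa h^s, whose expectation is
controlled by the moment assumption.  The choice lambda = C1 r^(1/kappa) balances both error
terms. *)

Set Implicit Arguments.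
Unset Strict Implicit.
Unset Printing Implicit Defensive.

Local Open Scope classical_set_scope.
Local Open Scope ring_scope.

(** * The power loss and its exponential *)

Section power_loss.
Context {R : realType}.
Implicit Types (a h lam m q t u v x : R).

(** Young's inequality for u^(q-1) and v with conjugate exponents q/(q-1) and q; it places the power
    function above its tangent at [u]. *)
Lemma powR_tangent q u v : 1 < q -> 0 <= u -> 0 <= v ->
  q * (u `^ (q - 1) * v) <= v `^ q + (q - 1) * u `^ q.
Proof.
move=> q1 u0 v0; have q0 : 0 < q by lra.
have qB0 : 0 < q - 1 by lra.
have pq : (q / (q - 1))^-1 + q^-1 = 1 by field; rewrite !gt_eqF.
have := conjugate_powR (powR_ge0 u (q - 1)) v0 (divr_gt0 q0 qB0) q0 pq.
rewrite -powRrM mulrCA divff ?gt_eqF// mulr1 => /(ler_wpM2l (ltW q0)).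
move/le_trans; apply; rewrite le_eqVlt; apply/orP; left; apply/eqP.
by field; rewrite !gt_eqF.
Qed.

Lemma norm_powR_tangent q m v : 1 < q ->
  `|m| `^ q + q * Num.sg m * `|m| `^ (q - 1) * (v - m) <= `|v| `^ q.
Proof.
move=> q1; have q0 : 0 < q by lra.
have := powR_tangent q1 (normr_ge0 m) (normr_ge0 v).
have E : `|m| `^ (q - 1) * `|m| = `|m| `^ q.
  by rewrite mulrC mulr_powRB1.
have p0 : 0 <= q * `|m| `^ (q - 1) by rewrite mulr_ge0 ?powR_ge0// ltW.
have mv : Num.sg m * v <= `|v|.
  rewrite (le_trans (ler_norm _))// normrM normr_sg.
  by case: eqP => _; rewrite /= ?mul0r ?mul1r ?normr_ge0.
have := ler_wpM2l p0 mv.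
have : Num.sg m * m = `|m| by rewrite -normrEsg.
move: E; set p := _ `^ (q - 1) => E sm; nra.
Qed.

(** With |v| <= |u| by symmetry, the tangent at the larger point |u| bounds the difference by q
    |u|^(q-1) (|u| - |v|). *)
Lemma powR_lipschitz q h u v : 1 < q -> `|u| <= h -> `|v| <= h ->
  `| `|u| `^ q - `|v| `^ q | <= q * h `^ (q - 1) * `|u - v|.
Proof.
move=> q1.
wlog uv : u v / `|v| <= `|u|.
  move=> W uh vh; have [|/ltW] := leP `|v| `|u|; first by move=> ?; exact: W.
  by move=> ?; rewrite distrC (distrC u); exact: W.
move=> uh vh; have q0 : 0 < q by lra.
rewrite ger0_norm; last by rewrite subr_ge0 ge0_ler_powR ?nnegrE// ltW.
have := powR_tangent q1 (normr_ge0 u) (normr_ge0 v).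
have E : `|u| `^ (q - 1) * `|u| = `|u| `^ q by rewrite mulrC mulr_powRB1.
have : `|u| `^ (q - 1) <= h `^ (q - 1).
  rewrite ge0_ler_powR ?nnegrE//; first by lra.
  exact: le_trans uh.
have := lerB_normD u (- v); rewrite normrN.
have := powR_ge0 `|u| (q - 1).
move: E; set p := _ `^ (q - 1); set H := h `^ _; set w := `|u - v|.
set a := `|u| in uv *; set b := `|v| in uv *; rewrite -/w => E p0 abw pH yo.
have : p * (a - b) <= H * w by rewrite ler_pM// subr_ge0.
nra.
Qed.

End power_loss.

(** * Exponential of the power loss: tangents and a second-order bound *)

Section exp_concave.
Context {R : realType}.
Implicit Types (a h lam m q t u v x : R).

(* The right-hand side over the left-hand side is nonincreasing in t up to 1 and
   nondecreasing after. *)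
Lemma expR_powR_tangent1 q a t : 1 < q -> 0 <= a -> 0 <= t ->
  a * q <= q - 1 -> a * q * t `^ q <= q - 1 ->
  expR (a * (1 - t `^ q)) <= 1 + a * q * (1 - t).
Proof.
move=> q1 a0 t0 aq aqt; have q0 : 0 < q by lra.
pose F x : R := (1 + a * q * (1 - x)) * expR (a * (x `^ q - 1)).
pose F' x : R := a * q * expR (a * (x `^ q - 1)) *
  (x `^ (q - 1) * (1 + a * q * (1 - x)) - 1).
suff : 1 <= F t.
  rewrite /F => Ft; rewrite -(@ler_pM2r _ (expR (a * (t `^ q - 1)))) ?expR_gt0//.
  by rewrite -expRD [X in expR X](_ : _ = 0) ?expR0//; ring.
have F1 : F 1 = 1 by rewrite /F powR1 subrr !mulr0 expR0 addr0 mulr1.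
have dF x : 0 < x -> is_derive x 1 F (F' x).
  move=> x0.
  have dp : is_derive x 1 (fun y : R => y `^ q) (q * x `^ (q - 1)).
    exact: is_derive1_powR.
  have dB : is_derive x 1 (fun y : R => a * (y `^ q - 1)) (a * (q * x `^ (q - 1))).
    have D := is_deriveZ a (is_deriveB dp (is_derive_cst (1 : R^o) x 1)).
    by rewrite subr0 in D; exact: D.
  have dA : is_derive x 1 (fun y : R => 1 + a * q * (1 - y)) (- (a * q)).
    have D := is_deriveD (is_derive_cst (1 : R^o) x 1)
      (is_deriveZ (a * q) (is_deriveB (is_derive_cst (1 : R^o) x 1)
        (is_derive_id x (1 : R^o)))).
    by rewrite add0r sub0r scalerN /GRing.scale/= mulr1 in D; exact: D.
  have dE := @is_derive1_comp _ expR _ x _ _ (is_derive_expR (a * (x `^ q - 1))) dB.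
  have D := is_deriveM dA dE.
  have dE' u : u = F' x -> is_derive x 1 F u -> is_derive x 1 F (F' x) by move=> ->.
  apply: dE' D; rewrite /F' /GRing.scale/=.
  by move: (expR _) (x `^ (q - 1)) => e p; ring.
have cF u v : 0 < u -> {within `[u, v], continuous F}.
  move=> u0; apply: derivable_within_continuous => x.
  by rewrite in_itv/= => /andP[ux _]; have [] := dF x (lt_le_trans u0 ux).
have F'E x : 0 < x -> (F^`() x)%classic = F' x.
  by move=> x0; rewrite derive1E (@derive_val _ _ _ _ _ _ _ (dF x x0)).
(* The derivative is available only at positive points, so t = 0 is checked directly: exp(-a) >= 1 -
   a, and (1 + aq)(1 - a) >= 1 because aq <= q - 1. *)
move: t0; rewrite le_eqVlt => /predU1P[<-|t0].
  rewrite /F powR0 ?gt_eqF// sub0r mulrN1 subr0 mulr1.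
  have := expR_ge1Dx (- a); have := expR_gt0 (- a).
  set e := expR _ => e0 ea.
  have : (1 + a * q) * (1 - a) <= (1 + a * q) * e.
    by rewrite ler_wpM2l//; nra.
  by apply: le_trans; nra.
have aq0 : 0 <= a * q by rewrite mulr_ge0// ltW.
clearbody F; rewrite -F1; have [t1|t1] := leP t 1.
  apply: (@ler0_derive1_nincr _ F t 1 _ _ (cF _ _ t0) _ _ (lexx t) t1 (lexx 1)).
    by move=> x; rewrite in_itv/= => /andP[tx _]; have [] := dF x (lt_trans t0 tx).
  move=> x; rewrite in_itv/= => /andP[tx x1]; have x0 := lt_trans t0 tx.
  rewrite F'E// /F' mulr_ge0_le0 ?subr_le0 ?(mulr_ge0 aq0) ?expR_ge0//.
  (* Below 1 the derivative is nonpositive: x^(q-1) (1 + aq(1 - x)) <= exp((q-1)(ln x + 1 - x)) <=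
     1. *)
  have lx : ln x <= x - 1.
    by have := @le_ln1Dx _ (x - 1); rewrite subrKC; apply; lra.
  have -> : x `^ (q - 1) = expR ((q - 1) * ln x) by rewrite /powR gt_eqF.
  have : 1 + a * q * (1 - x) <= expR ((q - 1) * (1 - x)).
    by apply: (le_trans _ (expR_ge1Dx _)); rewrite lerD2l ler_wpM2r//; lra.
  move=> /(ler_wpM2l (expR_ge0 ((q - 1) * ln x))) /le_trans; apply.
  by rewrite -expRD -[leRHS]expR0 ler_expR -mulrDr mulr_ge0_le0//; lra.
apply: (@ger0_derive1_ndecr _ F 1 t _ _ (cF _ _ ltr01) _ _ (lexx 1) (ltW t1)
  (lexx t)).
- move=> x; rewrite in_itv/= => /andP[x1 _].
  by have [] := dF x (lt_trans ltr01 x1).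
- move=> x; rewrite in_itv/= => /andP[x1 xt].
  have x0 : 0 < x by exact: lt_trans x1.
  rewrite F'E// /F' mulr_ge0// ?subr_ge0 ?(mulr_ge0 aq0) ?expR_ge0//.
  have xtq : x `^ q <= t `^ q by rewrite ge0_ler_powR ?nnegrE// ltW.
  have aqx : a * q * x `^ q <= q - 1.
    by apply: le_trans aqt; rewrite ler_wpM2l.
  (* Above 1, multiply the factor by x: x^q - aq x^q (x - 1) >= x^q - (q-1)(x - 1) >= x, the last
     step being the tangent at 1. *)
  have E := mulr_powRB1 (ltW x0) q0.
  have := powR_tangent q1 ler01 (ltW x0).
  rewrite !powR1 !mul1r !mulr1 => qx.
  rewrite -(@ler_pM2l _ x)// mulr1 mulrA E; nra.
Qed.

(* The tangent inequality at m for the concave function v |-> exp(- lam |v|^q) on [-h, h]. *)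
Lemma expR_powR_tangent q lam h m v : 1 < q -> 0 <= lam ->
  `|m| <= h -> `|v| <= h -> lam * q * h `^ q <= q - 1 ->
  expR (- (lam * `|v| `^ q)) <= expR (- (lam * `|m| `^ q)) *
    (1 - lam * (q * Num.sg m * `|m| `^ (q - 1)) * (v - m)).
Proof.
move=> q1 lam0 mh vh lamh; have q0 : 0 < q by lra.
have [->|m0] := eqVneq m 0.
  rewrite sgr0 !(mulr0, mul0r) normr0 powR0 ?gt_eqF// mulr0 oppr0 expR0 addr0.
  by rewrite mulr1 -expR0 ler_expR oppr_le0 mulr_ge0 ?powR_ge0.
have am0 : 0 < `|m| by rewrite normr_gt0.
(* Homogeneity: dividing by |m| moves the tangency point to 1 and reduces the claim to one variable
   [t]. *)
pose a := lam * `|m| `^ q; pose t := `|v| / `|m|.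
have lamq : 0 <= lam * q by rewrite mulr_ge0// ltW.
have tq : a * t `^ q = lam * `|v| `^ q.
  rewrite /a -mulrA -powRM ?divr_ge0//; congr (_ * _ `^ _).
  by rewrite /t mulrC divfK ?gt_eqF.
have h0 : 0 <= h by apply: le_trans mh.
have H u : `|u| <= h -> lam * q * `|u| `^ q <= q - 1.
  move=> uh; apply: le_trans lamh; rewrite ler_wpM2l// ge0_ler_powR ?nnegrE//.
  exact: ltW.
have a0 : 0 <= a by rewrite mulr_ge0// powR_ge0.
have t0 : 0 <= t by rewrite divr_ge0.
have aq : a * q <= q - 1 by rewrite mulrAC; exact: H.
have aqt : a * q * t `^ q <= q - 1 by rewrite mulrAC tq mulrAC; exact: H.
have := expR_powR_tangent1 q1 a0 t0 aq aqt.
rewrite mulrBr mulr1 tq => T.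
rewrite (_ : - (lam * `|v| `^ q) = - a + (a - lam * `|v| `^ q)); last by ring.
rewrite expRD ler_wpM2l ?expR_ge0// (le_trans T)//.
have -> : a * q * (1 - t) = lam * q * `|m| `^ (q - 1) * (`|m| - `|v|).
  have E : `|m| `^ q = `|m| * `|m| `^ (q - 1) by rewrite mulr_powRB1.
  by rewrite /a /t E; field; rewrite gt_eqF.
rewrite -[leRHS]addr0 -addrA lerD2l addr0.
have -> : - (lam * (q * Num.sg m * `|m| `^ (q - 1)) * (v - m)) =
  lam * q * `|m| `^ (q - 1) * (`|m| - Num.sg m * v).
  by rewrite (normrEsg m); ring.
rewrite ler_wpM2l ?(mulr_ge0 lamq) ?powR_ge0// lerD2l lerN2.
rewrite (le_trans (ler_norm _))// normrM normr_sg.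
by rewrite m0 mul1r.
Qed.

(** Write exp(x) as exp(-x/2)^(-2) <= (1 - x/2)^(-2); the right-hand side times (1 - x/2)^2 exceeds
    1 by x^2 (1 - x)(5/2 - x) / 2. *)
Lemma expR_quadratic_bound (x : R) : x <= 1 -> expR x <= 1 + x + 2 * x ^+ 2.
Proof.
move=> x1; have : 1 - x / 2 <= expR (- (x / 2)) by exact: expR_ge1Dx.
have -> : expR x = (expR (- (x / 2)) ^+ 2)^-1.
  by rewrite expr2 -expRD -expRN; congr expR; field.
have := expR_gt0 (- (x / 2)); set e := expR _ => e0 xe.
rewrite -[leLHS]mul1r ler_pdivrMr ?exprn_gt0//.
have : (1 - x / 2) ^+ 2 <= e ^+ 2 by nra.
have : 0 < 1 + x + 2 * x ^+ 2 by nra.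
set P := 1 + _ + _ => P0 ee.
have : P * (1 - x / 2) ^+ 2 <= P * e ^+ 2 by rewrite ler_pM2l.
apply: le_trans.
have -> : P * (1 - x / 2) ^+ 2 = 1 + x ^+ 2 / 2 * ((1 - x) * (5 / 2 - x)).
  by rewrite /P; field.
rewrite lerDl mulr_ge0 ?divr_ge0 ?sqr_ge0//.
by rewrite mulr_ge0; lra.
Qed.

End exp_concave.

(** * The gap between the loss of a mixture and the mixture of the losses *)

Section mixture_gap.
Context {R : realType} {F : choiceType}.
Variables (G : {fset F}) (rho : F -> R).
Hypothesis rho0 : forall g, g \in G -> 0 <= rho g.
Implicit Types (u v : F -> R) (a c q m h k lam D : R).

Lemma ler_fmean u v : (forall g, g \in G -> u g <= v g) ->
  fmean G rho u <= fmean G rho v.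
Proof.
move=> uv; rewrite /fmean !big_seq; apply: ler_sum => g gG.
by rewrite ler_wpM2l ?rho0// uv.
Qed.

Lemma fmeanD u v : fmean G rho (fun g => u g + v g) = fmean G rho u + fmean G rho v.
Proof. by rewrite /fmean -big_split; apply: eq_bigr => g _; rewrite mulrDr. Qed.

Lemma fmeanZ a u : fmean G rho (fun g => a * u g) = a * fmean G rho u.
Proof. by rewrite /fmean mulr_sumr; apply: eq_bigr => g _; rewrite mulrCA. Qed.

Hypothesis rho1 : \sum_(g <- G) rho g = 1.

Lemma fmean_cst a : fmean G rho (fun=> a) = a.
Proof. by rewrite /fmean -mulr_suml rho1 mul1r. Qed.

Lemma fmean_affine a c u :
  fmean G rho (fun g => a + c * u g) = a + c * fmean G rho u.
Proof. by rewrite fmeanD fmean_cst fmeanZ. Qed.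

Lemma norm_fmean_le h u : (forall g, g \in G -> `|u g| <= h) -> `|fmean G rho u| <= h.
Proof.
move=> uh; rewrite (le_trans (ler_norm_sum _ _ _))// -[leRHS]fmean_cst /fmean !big_seq.
apply: ler_sum => g gG; rewrite normrM ger0_norm ?rho0//.
by rewrite ler_wpM2l ?rho0// uh.
Qed.

(** Jensen's inequality for a function concave on [-h, h]: the tangent at the mean, which lies in
    the same interval, is averaged. *)
Lemma fmean_expR_exp_concave q lam h v : 1 < q -> 0 <= lam ->
  lam * q * h `^ q <= q - 1 -> (forall g, g \in G -> `|v g| <= h) ->
  fmean G rho (fun g => expR (- (lam * `|v g| `^ q))) <=
  expR (- (lam * `|fmean G rho v| `^ q)).
Proof.
move=> q1 lam0 lamh vh; set m := fmean G rho v.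
set al := lam * (q * Num.sg m * `|m| `^ (q - 1)); set e := expR (- (lam * `|m| `^ q)).
have -> : e = fmean G rho (fun g => (e + e * al * m) + (- (e * al)) * v g).
  by rewrite fmean_affine -/m; ring.
apply: ler_fmean => g gG.
apply: le_trans (expR_powR_tangent q1 lam0 (norm_fmean_le vh) (vh g gG) lamh) _.
by rewrite -/m -/al -/e le_eqVlt; apply/orP; left; apply/eqP; ring.
Qed.

Lemma fmean_norm_powR q v : 1 < q ->
  `|fmean G rho v| `^ q <= fmean G rho (fun g => `|v g| `^ q).
Proof.
move=> q1; set m := fmean G rho v; set al := q * Num.sg m * `|m| `^ (q - 1).
have -> : `|m| `^ q = fmean G rho (fun g => (`|m| `^ q - al * m) + al * v g).
  by rewrite fmean_affine -/m; ring.
apply: ler_fmean => g gG; apply: le_trans (norm_powR_tangent m (v g) q1).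
by rewrite -/al le_eqVlt; apply/orP; left; apply/eqP; ring.
Qed.

(** Relative to the loss of the mean, the exponents have size at most M by the Lipschitz bound and a
    nonpositive average by Jensen, so the first-order term of exp drops out. *)
Lemma fmean_expR_powR_bound q lam h D k v : 1 < q -> 0 <= lam -> 1 <= k <= 2 ->
  (forall g, g \in G -> `|v g| <= h) ->
  (forall g, g \in G -> `|v g - fmean G rho v| <= D) ->
  fmean G rho (fun g => expR (- (lam * `|v g| `^ q))) <=
  expR (- (lam * `|fmean G rho v| `^ q)) *
    expR (2 * (lam * (q * h `^ (q - 1) * D)) `^ k).
Proof.
move=> q1 lam0 /andP[k1 k2] vh vD; set m := fmean G rho v; set M := lam * (q * _ * _).
pose x g := - (lam * (`|v g| `^ q - `|m| `^ q)).
have hp : 0 <= q * h `^ (q - 1) by rewrite mulr_ge0 ?powR_ge0//; lra.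
have xM g : g \in G -> `|x g| <= M.
  move=> gG; rewrite /M normrN normrM (ger0_norm lam0) ler_wpM2l//.
  rewrite (le_trans (powR_lipschitz q1 (vh g gG) (norm_fmean_le vh)))//.
  by rewrite ler_wpM2l// vD.
have -> : fmean G rho (fun g => expR (- (lam * `|v g| `^ q))) =
    expR (- (lam * `|m| `^ q)) * fmean G rho (fun g => expR (x g)).
  rewrite -fmeanZ; congr fmean; apply/funext => g; rewrite -expRD; congr expR.
  by rewrite /x; ring.
rewrite ler_wpM2l ?expR_ge0//.
have mx : fmean G rho x <= 0.
  have -> : fmean G rho x = lam * `|m| `^ q - lam * fmean G rho (fun g => `|v g| `^ q).
    by rewrite -mulNr -fmean_affine; congr fmean; apply/funext => g; rewrite /x; ring.
  by rewrite subr_le0 ler_wpM2l// fmean_norm_powR.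
(* For M > 1 the crude bound exp(M) is enough, as M <= M^k; for M <= 1 the quadratic bound applies
   and M^2 <= M^k. *)
have [M1|M1] := leP M 1; last first.
  have : fmean G rho (fun g => expR (x g)) <= fmean G rho (fun=> expR M).
    by apply: ler_fmean => g gG; rewrite ler_expR (le_trans (ler_norm _)) ?xM.
  rewrite fmean_cst => /le_trans; apply; rewrite ler_expR.
  have := le1r_powR (ltW M1) k1; have := powR_ge0 M k; lra.
have : fmean G rho (fun g => expR (x g)) <=
    fmean G rho (fun g => (1 + 2 * M ^+ 2) + 1 * x g).
  apply: ler_fmean => g gG; have := xM _ gG; rewrite ler_norml => /andP[xM1 xM2].
  apply: le_trans (expR_quadratic_bound _) _; first exact: le_trans M1.
  by rewrite mul1r; nra.
rewrite fmean_affine => /le_trans; apply; rewrite mul1r.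
apply: (@le_trans _ _ (1 + 2 * M `^ k)); last exact: expR_ge1Dx.
suff : M ^+ 2 <= M `^ k by move: mx; lra.
have [M0|M0] := ltP 0 M; last first.
  suff -> : M = 0 by rewrite expr0n powR_ge0.
  have [g gG] : exists g, g \in G.
    apply/fset0Pn; apply/eqP => G0; move: rho1; rewrite G0 big_nil => /eqP.
    by rewrite eq_sym oner_eq0.
  by apply/eqP; rewrite eq_le M0 (le_trans _ (xM g gG)).
by rewrite -powR_mulrn ?ger_powR ?M0// ltW.
Qed.

End mixture_gap.

(** * The mixture gap of the L_q loss, in terms of lambda and |y| + b *)

Section Lq_mixture_gap.
Context {R : realType}.
Implicit Types (q s b : R).

(** The exponent kappa: lambda is C1 r^(1/kappa) and both error terms have order r^(1 - 1/kappa).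
    The two branches meet at s = 2q - 2 with value 2. *)
Definition rate_exp q s : R := if s < 2 * q - 2 then s / (q - 1) else (s + 2) / q.

(** [K] is fixed before the class, the weights, lambda and y, which makes the final constant
    uniform. *)
Lemma Lq_mixture_gap q s b : 1 < q -> q <= s -> 0 < b ->
  exists2 K : R, 0 <= K &
  forall (F : choiceType) (G : {fset F}) (rho : F -> R) (lam y : R) (u : F -> R),
  (forall g, g \in G -> 0 <= rho g) -> \sum_(g <- G) rho g = 1 -> 0 <= lam ->
  (forall g, g \in G -> `|u g| <= b) ->
  fmean G rho (fun g => expR (- (lam * `|y - u g| `^ q))) <=
  expR (- (lam * `|y - fmean G rho u| `^ q)) *
    expR (K * lam `^ rate_exp q s * (`|y| + b) `^ s).
Proof.
move=> q1 qs b0; have q0 : 0 < q by lra.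
have qB0 : 0 < q - 1 by lra.
have common (F : choiceType) (G : {fset F}) (rho : F -> R) (y : R) (u : F -> R) :
    (forall g, g \in G -> 0 <= rho g) -> \sum_(g <- G) rho g = 1 ->
    (forall g, g \in G -> `|u g| <= b) ->
    [/\ fmean G rho (fun g => y - u g) = y - fmean G rho u,
      forall g, g \in G -> `|y - u g| <= `|y| + b &
      forall g, g \in G -> `|y - u g - (y - fmean G rho u)| <= 2 * b].
  move=> rho0 rho1 ub; split.
  - have := fmean_affine rho1 y (-1) u; rewrite mulN1r => <-.
    by congr fmean; apply/funext => g; rewrite mulN1r.
  - by move=> g gG; rewrite (le_trans (ler_normB _ _))// lerD2l ub.
  - move=> g gG; have -> : y - u g - (y - fmean G rho u) = fmean G rho u - u g by ring.
    rewrite (le_trans (ler_normB _ _))// mulr2n mulrDl mul1r lerD ?ub//.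
    exact: norm_fmean_le.
rewrite /rate_exp; case: ifPn => [sq|]; last rewrite -leNgt => sq.
  (* The exponent k = s/(q-1) lies in [1, 2] and turns h^(q-1) into h^s; predictions deviate from
     their mean by at most D = 2b. *)
  exists (2 * (q * (2 * b)) `^ (s / (q - 1))).
    by rewrite mulr_ge0// powR_ge0.
  move=> F G rho lam y u rho0 rho1 lam0 ub; have [mE uh uD] := common _ _ _ y _ rho0 rho1 ub.
  have k12 : 1 <= s / (q - 1) <= 2.
    by rewrite ler_pdivlMr// ler_pdivrMr// mul1r; apply/andP; split; lra.
  have := @fmean_expR_powR_bound _ _ _ _ rho0 rho1 q lam (`|y| + b) (2 * b) _ (fun g => y - u g)
    q1 lam0 k12 uh.
  rewrite mE => /(_ uD) /le_trans; apply; rewrite ler_wpM2l ?expR_ge0// ler_expR.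
  have h0 : 0 <= `|y| + b by rewrite addr_ge0// ltW.
  have -> : lam * (q * (`|y| + b) `^ (q - 1) * (2 * b)) =
    (q * (2 * b)) * lam * (`|y| + b) `^ (q - 1) by ring.
  rewrite !powRM ?mulr_ge0 ?powR_ge0 ?(ltW q0) ?(ltW b0)//.
  rewrite -[in leLHS](powRrM (_ + _)) (mulrC (q - 1)) divfK ?gt_eqF//.
  by rewrite !mulrA.
(* Choice of [e]: 2 + e = (s+2)/q and 2(q-1) + qe = s, so the factor (lambda h^q)^e turns lambda^2
   h^(2(q-1)) into lambda^((s+2)/q) h^s. *)
pose e := (s - 2 * q + 2) / q.
have e0 : 0 <= e by rewrite divr_ge0 ?(ltW q0)//; lra.
have K0 : 0 <= 2 * (q * (2 * b)) ^+ 2 * (q / (q - 1)) `^ e.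
  by rewrite mulr_ge0 ?powR_ge0// mulr_ge0// sqr_ge0.
exists (2 * (q * (2 * b)) ^+ 2 * (q / (q - 1)) `^ e).
  exact: K0.
move=> F G rho lam y u rho0 rho1 lam0 ub; have [mE uh uD] := common _ _ _ y _ rho0 rho1 ub.
have h0 : 0 < `|y| + b by rewrite ltr_wpDl.
set h : R := `|y| + b in uh h0 *.
have [lamh|lamh] := leP (lam * q * h `^ q) (q - 1).
  have := fmean_expR_exp_concave rho0 rho1 q1 lam0 lamh uh.
  rewrite mE => /le_trans; apply; rewrite -[leLHS]mulr1 ler_wpM2l ?expR_ge0//.
  by rewrite -[leLHS]expR0 ler_expR mulr_ge0 ?powR_ge0// mulr_ge0 ?powR_ge0.
have := @fmean_expR_powR_bound _ _ _ _ rho0 rho1 q lam h (2 * b) 2 (fun g => y - u g)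
  q1 lam0 _ uh.
rewrite mE lexx ler1n => /(_ isT uD) /le_trans; apply.
rewrite ler_wpM2l ?expR_ge0// ler_expR.
rewrite powR_mulrn; last by rewrite !mulr_ge0 ?powR_ge0 ?(ltW q0) ?(ltW b0).
have lam_gt0 : 0 < lam.
  rewrite lt_neqAle lam0 andbT eq_sym; apply/eqP => l0.
  by move: lamh; rewrite l0 !mul0r; lra.
(* Outside the exp-concave regime, q/(q-1) lambda h^q is at least 1, so its e-th power may be
   inserted in the bound. *)
have : 1 <= (q / (q - 1)) `^ e * lam `^ e * h `^ (q * e).
  have : 0 <= q / (q - 1) by rewrite divr_ge0 ?ltW.
  have : 1 <= q / (q - 1) * lam * h `^ q.
    have -> : q / (q - 1) * lam * h `^ q = lam * q * h `^ q / (q - 1) by ring.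
    by rewrite ler_pdivlMr// mul1r ltW.
  move: (q / (q - 1)) => c c1 c0.
  rewrite powRrM -!powRM ?(mulr_ge0 c0) ?powR_ge0//.
  have E1 : 1 `^ e = 1 :> R by rewrite powR1.
  rewrite -[leLHS]E1 ge0_ler_powR ?nnegrE// ?mulr_ge0 ?powR_ge0//.
have -> : lam `^ ((s + 2) / q) = lam ^+ 2 * lam `^ e.
  rewrite -powR_mulrn// -powRD; last by rewrite (gt_eqF lam_gt0) implybT.
  by congr powR; rewrite /e; field; rewrite gt_eqF.
have -> : h `^ s = (h `^ (q - 1)) ^+ 2 * h `^ (q * e).
  rewrite -powR_mulrn ?powR_ge0// -powRrM -powRD; last by rewrite (gt_eqF h0) implybT.
  by congr powR; rewrite /e; field; rewrite gt_eqF.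
move: (lam `^ e) (h `^ (q - 1)) (h `^ (q * e)) (_ `^ e) => A B C E ACE.
rewrite [leRHS](_ : _ = 2 * (lam * (q * B * (2 * b))) ^+ 2 * (E * A * C)); last by ring.
by rewrite ler_peMr// mulr_ge0// sqr_ge0.
Qed.

End Lq_mixture_gap.

(** * Independence of an observation from the past *)

Section past.
Context {R : realType} {dO d : measure_display} {Omega : measurableType dO}
  {T : measurableType d} {Pr : probability Omega R} {n : nat}
  (P : probability T R) (Z : 'I_n -> {RV Pr >-> T}).
Implicit Types (i : nat) (k : 'I_n).

(** A pi-system generating the sigma-algebra of the observations of index below [i]; at i = 0 only
    the whole space remains. *)
Definition past_cylinder i : set (set Omega) :=
  [set B | exists2 A : 'I_n -> set T, (forall j, measurable (A j)) &
     B = \bigcap_(j in [set j : 'I_n | (j < i)%N]) (Z j @^-1` A j)].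

Lemma past_cylinderT i : past_cylinder i setT.
Proof.
exists (fun=> setT) => //; apply/seteqP; split => // w _ j _ //.
Qed.

Lemma past_cylinderI i : setI_closed (past_cylinder i).
Proof.
move=> _ _ [A mA ->] [B mB ->]; exists (fun j => A j `&` B j).
  by move=> j; exact: measurableI.
by rewrite -bigcapI; apply: eq_bigcapr => j _; rewrite preimage_setI.
Qed.

Lemma past_cylinder_measurable i : past_cylinder i `<=` measurable.
Proof.
move=> _ [A mA ->]; apply: fin_bigcap_measurable => [|j _].
  exact: finite_finset.
by rewrite -[X in measurable X]setTI; exact: measurable_funPT.
Qed.

Lemma past_measurable i : <<s past_cylinder i >> `<=` measurable.
Proof.
by apply: smallest_sub; [exact: sigma_algebra_measurable|exact: past_cylinder_measurable].
Qed.

Hypothesis iidZ : iid_from P Z.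

(** As i <= k keeps [k] outside the past, placing [C] at index [k] gives one instance of mutual
    independence. *)
Lemma past_cylinder_indep i k B C : (i <= k)%N -> past_cylinder i B ->
  measurable C -> Pr (B `&` Z k @^-1` C) = (Pr B * P C)%E.
Proof.
move=> ik [A mA ->] mC; have [indep law] := iidZ.
pose J : {set 'I_n} := [set j : 'I_n | (j < i)%N]%SET.
pose A' j := if j == k then C else A j.
have kJ : k \notin J by rewrite inE -leqNgt.
have mA' j : measurable (A' j) by rewrite /A'; case: ifP.
have JE : [set` J] = [set j : 'I_n | (j < i)%N].
  by apply/seteqP; split => j /=; rewrite inE.
have J'E : \bigcap_(j in [set` J]) (Z j @^-1` A' j) =
    \bigcap_(j in [set j : 'I_n | (j < i)%N]) (Z j @^-1` A j).
  rewrite JE; apply: eq_bigcapr => j /= ji; rewrite /A'; case: eqP => // jk.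
  by move: ji; rewrite jk ltnNge ik.
have <- : \bigcap_(j in [set` (k |: J)%SET]) (Z j @^-1` A' j) =
    \bigcap_(j in [set j : 'I_n | (j < i)%N]) (Z j @^-1` A j) `&` Z k @^-1` C.
  rewrite -J'E; apply/seteqP; split => [w H|w [H1 H2] j /=].
    split; last by have := H k; rewrite /A' eqxx; apply; rewrite /= setU11.
    by move=> j /= jJ; apply: H; rewrite /= inE jJ orbT.
  rewrite !inE => /orP[/eqP ->|ji]; first by rewrite /A' eqxx.
  by apply: H1; rewrite /= inE.
rewrite indep// big_setU1//= -J'E indep// muleC; congr (_ * _)%E.
by rewrite /A' eqxx -(law k).
Qed.

(** Both sides are finite measures in [B] that agree on the pi-system of cylinders, hence on the
    sigma-algebra it generates. *)
Lemma past_indep i k B C : (i <= k)%N -> <<s past_cylinder i >> B ->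
  measurable C -> Pr (B `&` Z k @^-1` C) = (Pr B * P C)%E.
Proof.
move=> ik sB mC.
have mZC : measurable (Z k @^-1` C).
  by rewrite -[X in measurable X]setTI; exact: measurable_funPT.
have PC : P C \is a fin_num by exact: fin_num_measure.
have PC0 : 0 <= fine (P C) by rewrite fine_ge0.
have m2E D : mscale (NngNum PC0) Pr D = (Pr D * P C)%E.
  by rewrite /mscale/= fineK// muleC.
rewrite -m2E.
apply: (@g_sigma_algebra_measure_unique _ _ _ _ (@past_cylinder_measurable i)
  (fun=> setT) _ _ (mrestr Pr mZC) (mscale (NngNum PC0) Pr)) => //.
- by move=> _; exact: past_cylinderT.
- by apply/seteqP; split => // w _; exists 0.
- exact: past_cylinderI.
- move=> D pD; transitivity (Pr D * P C)%E; last exact: (esym (m2E D)).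
  exact: past_cylinder_indep ik pD mC.
- move=> _; change (Pr (setT `&` (Z k @^-1` C)) < +oo)%E.
  by rewrite setTI (le_lt_trans (probability_le1 _ mZC)) ?ltry.
Qed.

(* Omega with the sigma-algebra of the observations Z_j, j < i; on the product of this
   space with T, the joint law of (w, Z_k w) for k >= i is a product measure. *)
Definition pastType i : measurableType (past_cylinder i).-sigma :=
  g_sigma_algebraType (past_cylinder i).

Lemma measurable_past_coord i k : (k < i)%N ->
  measurable_fun setT (Z k : pastType i -> T).
Proof.
move=> ki _ C mC; rewrite setTI; apply: sub_sigma_algebra.
exists (fun j => if j == k then C else setT).
  by move=> j; case: ifP.
apply/seteqP; split => [w wC j /= _|w]; first by case: eqP => // ->.
by move=> /(_ k ki); rewrite eqxx.
Qed.

Lemma measurable_past_id i : measurable_fun setT (id : Omega -> pastType i).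
Proof. by move=> _ B sB; rewrite setTI; exact: past_measurable sB. Qed.

Local Open Scope ereal_scope.

(** By [past_indep] the law of (w, Z_k w) factors on rectangles, hence is a product measure, and
    Tonelli's theorem applies. *)
Lemma freezing i k (f : pastType i * T -> \bar R) : (i <= k)%N ->
  (forall p, 0 <= f p) -> measurable_fun setT f ->
  \int[Pr]_w f (w, Z k w) = \int[Pr]_w \int[P]_z f (w, z).
Proof.
move=> ik f0 mf.
pose idi : {mfun Omega >-> pastType i} :=
  HB.pack (id : Omega -> pastType i) (isMeasurableFun.Build _ _ _ _ _ (@measurable_past_id i)).
have mpair : measurable_fun setT (fun w => (idi w, Z k w)).
  by apply: measurable_fun_pair; exact: measurable_funPT.
pose pairm : {mfun Omega >-> (pastType i * T)%type} :=
  HB.pack (fun w => (idi w, Z k w)) (isMeasurableFun.Build _ _ _ _ _ mpair).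
pose mu := distribution Pr idi.
have mE : forall D : set (pastType i * T), measurable D ->
    (mu \x P) D = distribution Pr pairm D.
  apply: product_measure_unique => B C mB mC.
  by rewrite -(@past_indep i k B C).
have -> : \int[Pr]_w f (w, Z k w) = \int[distribution Pr pairm]_p f p.
  rewrite ge0_integral_pushforward//.
have -> : \int[distribution Pr pairm]_p f p = \int[mu \x P]_p f p.
  by apply: eq_measure_integral => D mD _; exact: (esym (mE D mD)).
rewrite fubini_tonelli1// /fubini_F ge0_integral_pushforward//.
- exact: measurable_fun_fubini_tonelli_F.
- by move=> w _; exact: integral_ge0.
Qed.

Lemma integral_law k (f : T -> \bar R) : (forall z, 0 <= f z) ->
  measurable_fun setT f -> \int[Pr]_w f (Z k w) = \int[P]_z f z.
Proof.
move=> f0 mf; have [_ law] := iidZ.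
have <- : \int[distribution Pr (Z k)]_z f z = \int[P]_z f z.
  by apply: eq_measure_integral => D mD _; exact: law.
by rewrite ge0_integral_pushforward.
Qed.

End past.

(** * The progressive mixture *)

Section free_energy.
Context {R : realType} {F : choiceType}.
Variables (G : {fset F}) (lam : R).
Hypothesis G0 : G != fset0.
Implicit Types (c l : F -> R).

Lemma card_fset_gt0 : 0 < #|` G|%:R :> R.
Proof. by rewrite ltr0n cardfs_gt0. Qed.

Lemma funif_ge0 (g : F) : 0 <= funif G g :> R.
Proof. by rewrite invr_ge0 ltW// card_fset_gt0. Qed.

Lemma sum_funif : \sum_(g <- G) funif G g = 1 :> R.
Proof.
rewrite big_const_seq count_predT iter_addr_0 -[LHS]mulr_natl.
by apply: mulfV; rewrite gt_eqF// card_fset_gt0.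
Qed.

Definition free_energy c : R :=
  - ln (fmean G (funif G) (fun g => expR (- (lam * c g)))).

Lemma fmean_funif_expR_gt0 c : 0 < fmean G (funif G) (fun g => expR (c g)).
Proof.
have [g gG] : exists g, g \in G by apply/fset0Pn.
rewrite /fmean (big_fsetD1 g)//= ltr_wpDr//.
  by apply: sumr_ge0 => h _; rewrite mulr_ge0 ?funif_ge0 ?expR_ge0.
by rewrite mulr_gt0 ?expR_gt0// invr_gt0 card_fset_gt0.
Qed.

Lemma free_energyK c :
  expR (- free_energy c) = fmean G (funif G) (fun g => expR (- (lam * c g))).
Proof. by rewrite opprK lnK// posrE fmean_funif_expR_gt0. Qed.

(** Keeps all later integrands nonnegative, so that integrals may be infinite and no integrability
    has to be tracked. *)
Lemma free_energy_ge0 c : 0 <= lam -> (forall g, g \in G -> 0 <= c g) ->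
  0 <= free_energy c.
Proof.
move=> lam0 c0; rewrite oppr_ge0 ln_le0// -[leRHS](fmean_cst sum_funif 1).
apply: ler_fmean => [g _|g gG]; first exact: funif_ge0.
by rewrite -expR0 ler_expR oppr_le0 mulr_ge0// c0.
Qed.

(** Keeping only the term of [g], of mass 1/|G|, in the average costs ln |G|. *)
Lemma free_energy_le c (g : F) : g \in G ->
  free_energy c <= lam * c g + ln #|` G|%:R.
Proof.
move=> gG; rewrite -[leLHS]opprK lerNl opprD -lnV ?posrE ?card_fset_gt0//.
rewrite -{1}[- (lam * c g)]expRK -lnM ?posrE ?expR_gt0 ?invr_gt0 ?card_fset_gt0//.
rewrite opprK ler_ln ?posrE ?fmean_funif_expR_gt0//; last first.
  by rewrite mulr_gt0 ?expR_gt0// invr_gt0 card_fset_gt0.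
rewrite /fmean (big_fsetD1 g)//= mulrC lerDl.
by apply: sumr_ge0 => h _; rewrite mulr_ge0 ?funif_ge0 ?expR_ge0.
Qed.

Lemma gibbs_ge0 c (g : F) : 0 <= gibbs G (funif G) (fun g => lam * c g) g.
Proof.
by rewrite mulr_ge0 ?funif_ge0// divr_ge0 ?expR_ge0// ltW// fmean_funif_expR_gt0.
Qed.

Lemma fmean_gibbs c (u : F -> R) : fmean G (gibbs G (funif G) (fun g => lam * c g)) u =
  expR (free_energy c) *
  fmean G (funif G) (fun g => expR (- (lam * c g)) * u g).
Proof.
rewrite -[free_energy c]opprK expRN free_energyK -fmeanZ; apply: eq_bigr => g _.
by rewrite /gibbs; ring.
Qed.

Lemma sum_gibbs c : \sum_(g <- G) gibbs G (funif G) (fun g => lam * c g) g = 1.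
Proof.
transitivity (fmean G (gibbs G (funif G) (fun g => lam * c g)) (fun=> 1)).
  by apply: eq_bigr => g _; rewrite mulr1.
rewrite fmean_gibbs (_ : (fun g => _) = fun g => expR (- (lam * c g))).
  by rewrite -free_energyK -expRD subrr expR0.
by apply/funext => g; rewrite mulr1.
Qed.

(** The Gibbs mean is a ratio of two partition functions, one before and one after adding [l]; the
    difference of their logarithms is what telescopes. *)
Lemma fmean_gibbs_expR c l :
  fmean G (gibbs G (funif G) (fun g => lam * c g)) (fun g => expR (- (lam * l g))) =
  expR (free_energy c - free_energy (fun g => c g + l g)).
Proof.
rewrite fmean_gibbs expRD free_energyK; congr (_ * fmean _ _ _).
by apply/funext => g; rewrite -expRD; congr expR; ring.
Qed.

Lemma measurable_fmean {d} {Y : measurableType d} (rho u : Y -> F -> R) :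
  (forall g, g \in G -> measurable_fun setT (rho^~ g)) ->
  (forall g, g \in G -> measurable_fun setT (u^~ g)) ->
  measurable_fun setT (fun y => fmean G (rho y) (u y)).
Proof.
move=> mrho mu.
rewrite [X in measurable_fun _ X](_ : _ = fun y => \sum_(g <- G)
    (if g \in G then rho y g * u y g else 0)); last first.
  by apply/funext => y; rewrite /fmean !big_seq; apply: eq_bigr => g ->.
apply: measurable_sum => g; have [gG|gG] := boolP (g \in G); last exact: measurable_cst.
by apply: measurable_funM; [exact: mrho|exact: mu].
Qed.

Lemma measurable_free_energy {d} {Y : measurableType d} (c : Y -> F -> R) :
  (forall g, g \in G -> measurable_fun setT (c^~ g)) ->
  measurable_fun setT (fun y => free_energy (c y)).
Proof.
move=> mc; apply: measurableT_comp => //; apply: measurableT_comp => //.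
apply: measurable_fmean => g gG; first exact: measurable_cst.
apply: measurableT_comp => //; apply: measurableT_comp => //.
by apply: measurable_funM; [exact: measurable_cst|exact: mc].
Qed.

End free_energy.

(** * Telescoping the risks of the progressive mixture for an abstract loss *)

Section progressive_mixture.
Context {R : realType} {dO d : measure_display} {Omega : measurableType dO}
  {T : measurableType d} {Pr : probability Omega R} {n : nat}.
Variables (P : probability T R) (Z : 'I_n -> {RV Pr >-> T}).
Hypothesis iidZ : iid_from P Z.
Context {F : choiceType}.
Variables (G : {fset F}) (lam : R) (ell : F -> T -> R).
Hypotheses (G0 : G != fset0) (lam_gt0 : 0 < lam).
Hypothesis ell_ge0 : forall g z, 0 <= ell g z.
Hypothesis ell_meas : forall g, measurable_fun setT (ell g).

Let cumul (i : nat) (w : Omega) (g : F) : R :=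
  \sum_(j < n | (j < i)%N) ell g (Z j w).

Let cumul_ge0 i w g : 0 <= cumul i w g.
Proof. by apply: sumr_ge0 => j _; exact: ell_ge0. Qed.

Let cumulS (k : 'I_n) w g : cumul k.+1 w g = cumul k w g + ell g (Z k w).
Proof.
rewrite /cumul (bigD1 k)//= addrC; congr (_ + _); apply: eq_bigl => j.
by rewrite ltnS ltn_neqAle andbC.
Qed.

(** Measurability is for the sigma-algebra of the past, as [freezing] requires; the version on
    [Omega] follows through the identity map. *)
Let measurable_cumul i g : measurable_fun setT (fun w : pastType Z i => cumul i w g).
Proof.
rewrite [X in measurable_fun _ X](_ : _ = fun w : pastType Z i => \sum_(j < n)
    (if (j < i)%N then ell g (Z j w) else 0)); last first.
  by apply/funext => w; rewrite /cumul big_mkcond.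
apply: measurable_sum => j; have [ji|ji] := boolP (j < i)%N; last exact: measurable_cst.
exact: measurableT_comp (ell_meas g) (@measurable_past_coord _ _ _ _ _ _ _ Z _ _ ji).
Qed.

Let measurable_cumul_full i g : measurable_fun setT (fun w : Omega => cumul i w g).
Proof. exact: measurableT_comp (@measurable_cumul i g) (@measurable_past_id _ _ _ _ _ _ _ Z i). Qed.

(** The additional observation stays a free variable, so that it can be a fresh draw from [P] or the
    next element of the sample. *)
Let next i w z := free_energy G lam (fun g => cumul i w g + ell g z).

Let next_ge0 i w z : 0 <= next i w z.
Proof.
apply: free_energy_ge0 => //; first exact: ltW.
by move=> g _; rewrite addr_ge0.
Qed.

Let measurable_next i :
  measurable_fun setT (fun p : pastType Z i * T => (next i p.1 p.2)%:E).
Proof.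
apply/measurable_EFinP.
apply: (@measurable_free_energy _ F G lam _ (pastType Z i * T)%type
  (fun p g => cumul i p.1 g + ell g p.2)) => g _.
apply: measurable_funD.
  exact: measurableT_comp (@measurable_cumul i g) measurable_fst.
exact: measurableT_comp (ell_meas g) measurable_snd.
Qed.

Let measurable_next_full i :
  measurable_fun setT (fun p : Omega * T => (next i p.1 p.2)%:E).
Proof.
apply/measurable_EFinP.
apply: (@measurable_free_energy _ F G lam _ (Omega * T)%type
  (fun p g => cumul i p.1 g + ell g p.2)) => g _.
apply: measurable_funD.
  exact: measurableT_comp (@measurable_cumul_full i g) measurable_fst.
exact: measurableT_comp (ell_meas g) measurable_snd.
Qed.

Local Open Scope ereal_scope.

(** Indices start at 0, so [Z k] is independent of [cumul k]: freezing exchanges the fresh draw for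
    [Z k], whose loss completes [cumul k.+1]. *)
Let expected_next (k : 'I_n) :
  \int[Pr]_w \int[P]_z (next k w z)%:E =
  \int[Pr]_w (free_energy G lam (cumul k.+1 w))%:E.
Proof.
transitivity (\int[Pr]_w (next k w (Z k w))%:E).
  have f0 (p : pastType Z k * T) : 0 <= (next k p.1 p.2)%:E by rewrite lee_fin.
  have E := @freezing _ _ _ _ _ _ _ P Z iidZ k k _ (leqnn k) f0 (@measurable_next k).
  exact/esym/E.
apply: eq_integral => w _; congr (free_energy _ _ _)%:E; apply/funext => g.
by rewrite cumulS.
Qed.

(** At i = n no observation is left to replace the fresh draw, so the free energy is bounded through
    [g]: n observed losses and one fresh loss of equal mean give the factor n + 1. *)
Let expected_last g : g \in G ->
  \int[Pr]_w \int[P]_z (next n w z)%:E <=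
  (lam * n.+1%:R)%:E * \int[P]_z (ell g z)%:E + (ln #|` G|%:R)%:E.
Proof.
move=> gG.
have lam0 : 0 <= lam%:E by rewrite lee_fin ltW.
have lnG : (0 <= ln (#|` G|%:R : R))%R.
  by rewrite ln_ge0// ler1n cardfs_gt0.
have mell : measurable_fun setT (fun z => (ell g z)%:E) by exact/measurable_EFinP.
have ell0 : 0 <= \int[P]_z (ell g z)%:E by apply: integral_ge0 => z _; rewrite lee_fin.
have H w : \int[P]_z (next n w z)%:E <=
    (lam * cumul n w g + ln #|` G|%:R)%:E + lam%:E * \int[P]_z (ell g z)%:E.
  have c0 : (0 <= lam * cumul n w g + ln #|` G|%:R)%R.
    by rewrite addr_ge0// mulr_ge0// ltW.
  apply: (@le_trans _ _ (\int[P]_z ((lam * cumul n w g + ln #|` G|%:R)%:E +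
      lam%:E * (ell g z)%:E))).
    apply: ge0_le_integral => //.
    - by move=> z _; rewrite lee_fin.
    - by apply: measurableT_comp (@measurable_next_full n) (measurable_pair1 w).
    - by apply: emeasurable_funD => //; exact: measurable_funeM.
    - move=> z _; rewrite -EFinM -EFinD lee_fin.
      rewrite (le_trans (@free_energy_le _ _ _ lam G0 _ _ gG))//.
      by rewrite mulrDr -addrA [X in (_ + X)%R]addrC addrA.
  rewrite ge0_integralD//=; last 2 first.
  - by move=> z _; rewrite mule_ge0// lee_fin.
  - exact: measurable_funeM.
  by rewrite integral_cst//= probability_setT mule1 ge0_integralZl// => z _; rewrite lee_fin.
apply: (@le_trans _ _ (\int[Pr]_w ((lam * cumul n w g + ln #|` G|%:R)%:E +
    lam%:E * \int[P]_z (ell g z)%:E))).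
  apply: ge0_le_integral => //.
  - by move=> w _; apply: integral_ge0 => z _; rewrite lee_fin.
  - apply: (measurable_fun_fubini_tonelli_F (fun p => (next n p.1 p.2)%:E)) => //.
    by move=> p; rewrite lee_fin.
  - apply: emeasurable_funD => //; apply/measurable_EFinP; apply: measurable_funD => //.
    by apply: measurable_funM => //; exact: measurable_cumul_full.
have mc : measurable_fun setT (fun w => (cumul n w g)%:E).
  by apply/measurable_EFinP; exact: measurable_cumul_full.
have c0 w : 0 <= (cumul n w g)%:E by rewrite lee_fin.
rewrite ge0_integralD//=; last 3 first.
- by move=> w _; rewrite lee_fin addr_ge0// mulr_ge0// ltW.
- apply/measurable_EFinP; apply: measurable_funD => //.
  by apply: measurable_funM => //; exact: measurable_cumul_full.
- by move=> w _; rewrite mule_ge0.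
under eq_integral do rewrite EFinD EFinM.
rewrite ge0_integralD//=; last 2 first.
- by move=> w _; rewrite mule_ge0.
- exact: measurable_funeM.
rewrite ge0_integralZl//.
have -> : \int[Pr]_w (cumul n w g)%:E = n%:R%:E * \int[P]_z (ell g z)%:E.
  under eq_integral => w _.
    rewrite /cumul -sumEFin (eq_bigl xpredT); last by move=> j; rewrite ltn_ord.
    over.
  rewrite ge0_integral_sum//; last 2 first.
  - move=> j; apply: measurableT_comp mell _; exact: measurable_funPT.
  - by move=> j w _; rewrite lee_fin.
  have L (j : 'I_n) : \int[Pr]_w (ell g (Z j w))%:E = \int[P]_z (ell g z)%:E.
    apply: (@integral_law _ _ _ _ _ _ _ P Z iidZ j (fun z => (ell g z)%:E)) => //.
    by move=> z; rewrite lee_fin.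
  under eq_bigr do rewrite L.
  by rewrite sumr_const card_ord mule_natl.
rewrite !integral_cst//= !probability_setT !mule1.
rewrite EFinM -muleA -addeA [X in _ + X]addeC addeA -ge0_muleDr//; last first.
  by rewrite mule_ge0// lee_fin.
rewrite [X in _ <= lam%:E * (X * _) + _](_ : _ = n%:R%:E + 1); last by rewrite -EFinD natr1.
by rewrite ge0_muleDl ?mul1e// lee_fin.
Qed.

(** [lossM i w z] stands for the loss at [z] of the i-th mixture built from the sample, and [psi]
    for its gap to the exponential mean. *)
Variables (lossM : nat -> Omega -> T -> R) (psi : T -> R).
Hypothesis lossM_ge0 : forall i w z, (0 <= lossM i w z)%R.
Hypothesis lossM_meas : forall i,
  measurable_fun setT (fun p : Omega * T => lossM i p.1 p.2).
Hypothesis psi_ge0 : forall z, (0 <= psi z)%R.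
Hypothesis psi_meas : measurable_fun setT psi.
Hypothesis mix_gap : forall i w z,
  (lam * lossM i w z + free_energy G lam (cumul i w) <= next i w z + psi z)%R.

Let mixrisk i w := \int[P]_z (lossM i w z)%:E.

Let mixrisk_ge0 i w : 0 <= mixrisk i w.
Proof. by apply: integral_ge0 => z _; rewrite lee_fin. Qed.

Let measurable_mixrisk i : measurable_fun setT (mixrisk i).
Proof.
apply: (measurable_fun_fubini_tonelli_F (fun p => (lossM i p.1 p.2)%:E)) => //.
  exact/measurable_EFinP.
by move=> p; rewrite lee_fin.
Qed.

(** [mix_gap] is integrated over [z], then over the sample. Free energies are added on their own
    sides, since possibly infinite integrals cannot safely be subtracted. *)
Let mixrisk_step i :
  lam%:E * \int[Pr]_w mixrisk i w + \int[Pr]_w (free_energy G lam (cumul i w))%:E <=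
  \int[Pr]_w \int[P]_z (next i w z)%:E + \int[P]_z (psi z)%:E.
Proof.
have lam0 : 0 <= lam%:E by rewrite lee_fin ltW.
have mpsi : measurable_fun setT (fun z => (psi z)%:E) by exact/measurable_EFinP.
have psi0 : 0 <= \int[P]_z (psi z)%:E by apply: integral_ge0 => z _; rewrite lee_fin.
have fe0 w : (0 <= free_energy G lam (cumul i w))%R.
  by apply: free_energy_ge0 => //; rewrite ltW.
have mfe : measurable_fun setT (fun w => (free_energy G lam (cumul i w))%:E).
  apply/measurable_EFinP; apply: measurable_free_energy => g _.
  exact: measurable_cumul_full.
have mloss w : measurable_fun setT (fun z => (lossM i w z)%:E).
  apply/measurable_EFinP.
  by apply: measurableT_comp (@lossM_meas i) (measurable_pair1 w).
have mnext w : measurable_fun setT (fun z => (next i w z)%:E).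
  by apply: measurableT_comp (@measurable_next_full i) (measurable_pair1 w).
have H w : lam%:E * mixrisk i w + (free_energy G lam (cumul i w))%:E <=
    \int[P]_z (next i w z)%:E + \int[P]_z (psi z)%:E.
  rewrite -ge0_integralD//; [|by move=> z _; rewrite lee_fin..].
  rewrite -ge0_integralZl//; [|by move=> z _; rewrite lee_fin].
  have -> : (free_energy G lam (cumul i w))%:E =
      \int[P]_z (free_energy G lam (cumul i w))%:E.
    by rewrite integral_cst//= probability_setT mule1.
  rewrite -ge0_integralD//; last 3 first.
  - by move=> z _; rewrite mule_ge0// lee_fin.
  - exact: measurable_funeM.
  - by move=> z _; rewrite lee_fin.
  apply: ge0_le_integral => //.
  - by move=> z _; rewrite adde_ge0// ?mule_ge0 ?lee_fin.
  - by apply: emeasurable_funD => //; exact: measurable_funeM.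
  - exact: emeasurable_funD.
  - by move=> z _; rewrite -EFinM -!EFinD lee_fin.
have mint : measurable_fun setT (fun w => \int[P]_z (next i w z)%:E).
  apply: (measurable_fun_fubini_tonelli_F (fun p => (next i p.1 p.2)%:E)) => //.
  by move=> p; rewrite lee_fin.
rewrite -ge0_integralZl//.
rewrite -ge0_integralD//; last 3 first.
- by move=> w _; rewrite mule_ge0.
- exact: measurable_funeM.
- by move=> w _; rewrite lee_fin.
apply: (@le_trans _ _ (\int[Pr]_w (\int[P]_z (next i w z)%:E + \int[P]_z (psi z)%:E))).
  apply: ge0_le_integral => //.
  - by move=> w _; rewrite adde_ge0// ?mule_ge0// lee_fin.
  - by apply: emeasurable_funD => //; exact: measurable_funeM.
  - exact: emeasurable_funD.
rewrite ge0_integralD//; last first.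
  by move=> w _; apply: integral_ge0 => z _; rewrite lee_fin.
by rewrite integral_cst//= probability_setT mule1.
Qed.

Let telescope_step (x r a a' c : \bar R) k : 0 <= c ->
  x <= a + k%:R%:E * c -> r + a <= a' + c -> x + r <= a' + k.+1%:R%:E * c.
Proof.
move=> c0 xa ra; apply: (le_trans (leeD2r r xa)).
rewrite addeAC [a + r]addeC -natr1 EFinD ge0_muleDl ?lee_fin// mul1e.
by rewrite [k%:R%:E * c + c]addeC addeA leeD2r.
Qed.

(** By induction, [mixrisk_step] and [expected_next] cancel successive free energies; the base case
    rests on their nonnegativity. *)
Let mixrisk_sum k : (k <= n)%N ->
  lam%:E * (\sum_(i < k) \int[Pr]_w mixrisk i w) <=
  \int[Pr]_w (free_energy G lam (cumul k w))%:E + k%:R%:E * \int[P]_z (psi z)%:E.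
Proof.
have mr0 i : 0 <= \int[Pr]_w mixrisk i w by apply: integral_ge0.
have psi0 : 0 <= \int[P]_z (psi z)%:E by apply: integral_ge0 => z _; rewrite lee_fin.
elim: k => [_|k IH kn].
  rewrite big_ord0 mule0 mul0e adde0; apply: integral_ge0 => w _.
  by rewrite lee_fin; apply: free_energy_ge0 => //; rewrite ltW.
rewrite big_ord_recr/= ge0_muleDr//; last by apply: sume_ge0.
apply: telescope_step (IH (ltnW kn)) _ => //.
by have := mixrisk_step k; rewrite (expected_next (Ordinal kn)).
Qed.

Lemma progressive_mixture_bound g : g \in G ->
  \int[Pr]_w ((n.+1%:R^-1)%:E * \sum_(i < n.+1) \int[P]_z (lossM i w z)%:E) <=
  \int[P]_z (ell g z)%:E + (ln #|` G|%:R / (lam * n.+1%:R))%:E +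
  (lam^-1)%:E * \int[P]_z (psi z)%:E.
Proof.
move=> gG.
have mr0 i : 0 <= \int[Pr]_w mixrisk i w by apply: integral_ge0.
have psi0 : 0 <= \int[P]_z (psi z)%:E by apply: integral_ge0 => z _; rewrite lee_fin.
have lamn : (0 < lam * n.+1%:R)%R by rewrite mulr_gt0// ltr0n.
have -> : \int[Pr]_w ((n.+1%:R^-1)%:E * \sum_(i < n.+1) \int[P]_z (lossM i w z)%:E) =
    (n.+1%:R^-1)%:E * \sum_(i < n.+1) \int[Pr]_w mixrisk i w.
  rewrite ge0_integralZl//.
  - rewrite ge0_integral_sum// => i; first exact: measurable_mixrisk.
    by move=> w _; exact: mixrisk_ge0.
  - by apply: emeasurable_sum => i; exact: measurable_mixrisk.
  - by move=> w _; apply: sume_ge0 => i _; exact: mixrisk_ge0.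
have H : lam%:E * (\sum_(i < n.+1) \int[Pr]_w mixrisk i w) <=
    (lam * n.+1%:R)%:E * \int[P]_z (ell g z)%:E + (ln #|` G|%:R)%:E +
    n.+1%:R%:E * \int[P]_z (psi z)%:E.
  (* The first n mixtures telescope; the last one is closed by [expected_last]. *)
  rewrite big_ord_recr/= ge0_muleDr//; last by apply: sume_ge0.
  apply: telescope_step (mixrisk_sum (leqnn n)) _ => //.
  by apply: (le_trans (mixrisk_step n)); rewrite leeD2r// expected_last.
rewrite -(@lee_pmul2l _ (lam * n.+1%:R)%:E)//= ?lte_fin//.
rewrite muleA -EFinM mulfK ?pnatr_eq0//.
apply: (le_trans H); rewrite le_eqVlt; apply/orP; left; apply/eqP.
have ell0 : 0 <= \int[P]_z (ell g z)%:E by apply: integral_ge0 => z _; rewrite lee_fin.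
have lnG : (0 <= ln (#|` G|%:R : R))%R.
  by rewrite ln_ge0// ler1n cardfs_gt0.
clear H; have ln0 : 0 <= (ln #|` G|%:R / (lam * n.+1%:R))%:E.
  by rewrite lee_fin divr_ge0 ?(ltW lamn).
have psil : 0 <= (lam^-1)%:E * \int[P]_z (psi z)%:E.
  by rewrite mule_ge0// lee_fin invr_ge0 ltW.
move: (\int[P]_z (ell g z)%:E) (\int[P]_z (psi z)%:E) ell0 psil => e p e0 p0.
rewrite ge0_muleDr ?adde_ge0// ge0_muleDr// muleA -!EFinM.
rewrite (mulrCA (lam * n.+1%:R)%R) mulfV ?gt_eqF// mulr1.
by rewrite mulrAC mulfV ?gt_eqF// mul1r.
Qed.

End progressive_mixture.

(** * The L_q regression problem *)

Section rates.
Context {R : realType}.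
Implicit Types (q s : R).

Lemma rate_exp_gt1 q s : 1 < q -> q <= s -> 1 < rate_exp q s.
Proof.
move=> q1 qs; rewrite /rate_exp; case: ifPn => [_|].
  by rewrite ltr_pdivlMr ?mul1r; lra.
by rewrite -leNgt => sq; rewrite ltr_pdivlMr ?mul1r; lra.
Qed.

Lemma temperatureE C1 q s r : temperature C1 q s r = C1 * r `^ (rate_exp q s)^-1.
Proof. by rewrite /temperature /rate_exp; case: ifP; rewrite invf_div. Qed.

(** At s = 2q - 2 [rate_exp] takes its other branch, but both give the exponent 1/2, so the first
    rate covers the boundary. *)
Lemma rate_exp_le q s : 1 < q -> s <= 2 * q - 2 -> (q - 1) / s = (rate_exp q s)^-1.
Proof.
move=> q1; rewrite le_eqVlt => /predU1P[->|sq].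
  by rewrite /rate_exp ltxx; field; rewrite !gt_eqF//; lra.
by rewrite /rate_exp sq invf_div.
Qed.

Lemma rate_exp_ge q s : 2 * q - 2 <= s -> q / (s + 2) = (rate_exp q s)^-1.
Proof. by move=> sq; rewrite /rate_exp ltNge sq invf_div. Qed.

End rates.

Section Lq_regression.
Context {R : realType} {d : measure_display} {X : measurableType d}.
Variables (P : probability (X * R)%type R).
Implicit Types (G : {fset {mfun X >-> R}}) (q s b A lam : R).

Lemma Lq_loss_ge0 q z (g : X -> R) : 0 <= Lq_loss q z g.
Proof. exact: powR_ge0. Qed.

Lemma measurable_Lq_loss q (g : {mfun X >-> R}) :
  measurable_fun setT (fun z : X * R => Lq_loss q z g).
Proof.
apply: (measurableT_comp (measurable_powR q)); apply: measurableT_comp => //.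
apply: measurable_funB; first exact: measurable_snd.
by apply: measurableT_comp => //; exact: measurable_fst.
Qed.

Lemma measurable_shifted_moment b s :
  measurable_fun setT (fun z : X * R => (`|z.2| + b) `^ s).
Proof.
apply: (measurableT_comp (measurable_powR s)); apply: measurable_funD => //.
by apply: measurableT_comp => //; exact: measurable_snd.
Qed.

(** Pointwise, y + b <= 2 max(y, b), whose s-th power is at most 2^s (y^s + b^s). *)
Lemma shifted_moment_le b s A : 0 <= b -> 0 <= s ->
  (\int[P]_z (`|z.2| `^ s)%:E <= A%:E)%E ->
  (\int[P]_z ((`|z.2| + b) `^ s)%:E <= (2 `^ s * (A + b `^ s))%:E)%E.
Proof.
move=> b0 s0 PA.
have m1 : measurable_fun setT (fun z : X * R => (`|z.2| `^ s)%:E).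
  apply/measurable_EFinP; apply: (measurableT_comp (measurable_powR s)).
  by apply: measurableT_comp => //; exact: measurable_snd.
apply: (@le_trans _ _ (\int[P]_z ((2 `^ s)%:E * ((`|z.2| `^ s)%:E + (b `^ s)%:E)))%E).
  apply: ge0_le_integral => //.
  - by move=> z _; rewrite lee_fin powR_ge0.
  - by apply/measurable_EFinP; exact: measurable_shifted_moment.
  - by apply: measurable_funeM; exact: emeasurable_funD.
  - move=> z _; rewrite -EFinD -EFinM lee_fin mulrDr -!powRM//.
    set y := `|z.2|; have y0 : 0 <= y by exact: normr_ge0.
    have [yb|yb] := leP y b.
    + apply: (@le_trans _ _ ((2 * b) `^ s)); last by rewrite lerDr powR_ge0.
      by rewrite ge0_ler_powR ?nnegrE ?addr_ge0 ?mulr_ge0// mulr2n mulrDl !mul1r lerD2r.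
    + apply: (@le_trans _ _ ((2 * y) `^ s)); last by rewrite lerDl powR_ge0.
      rewrite ge0_ler_powR ?nnegrE ?addr_ge0 ?mulr_ge0// mulr2n mulrDl !mul1r lerD2l.
      exact: ltW.
rewrite ge0_integralZl//; last 2 first.
- exact: emeasurable_funD.
- by move=> z _; rewrite -EFinD lee_fin addr_ge0 ?powR_ge0.
rewrite EFinM; apply: lee_wpmul2l; first by rewrite lee_fin powR_ge0.
rewrite ge0_integralD//; [|by move=> z _; rewrite lee_fin powR_ge0..].
by rewrite integral_cst//= probability_setT mule1 EFinD leeD2r.
Qed.

End Lq_regression.

(** The seed +oo of the iterated minimum satisfies the bound trivially, and each binary minimum
    preserves it. *)
Lemma le_bigmine (R : realType) (F : choiceType) (G : {fset F}) (f : F -> \bar R)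
    (x : \bar R) (c : R) :
  (forall g, g \in G -> x <= f g + c%:E)%E ->
  (x <= \big[mine/+oo]_(g <- G) f g + c%:E)%E.
Proof.
move=> H; rewrite big_seq.
apply: (big_ind (fun y => x <= y + c%:E)%E) => //=; first by rewrite leey.
by move=> y z xy xz; rewrite /mine; case: ifP.
Qed.

Section gibbs_measurability.
Context {R : realType} {F : choiceType}.
Variables (G : {fset F}) (lam : R).
Hypothesis G0 : G != fset0.

Lemma gibbsE (c : F -> R) g : gibbs G (funif G) (fun g => lam * c g) g =
  expR (free_energy G lam c - lam * c g) * funif G g.
Proof.
rewrite /gibbs -free_energyK// -expRN opprK expRD.
by rewrite [X in X * _ = _]mulrC.
Qed.

Lemma measurable_gibbs {d} {Y : measurableType d} (c : Y -> F -> R) g : g \in G ->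
  (forall g, g \in G -> measurable_fun setT (c^~ g)) ->
  measurable_fun setT (fun y => gibbs G (funif G) (fun g => lam * c y g) g).
Proof.
move=> gG mc.
rewrite [X in measurable_fun _ X](_ : _ = fun y =>
    expR (free_energy G lam (c y) - lam * c y g) * funif G g).
  apply: measurable_funM => //; apply: measurableT_comp => //.
  apply: measurable_funB; first exact: measurable_free_energy.
  by apply: measurable_funM => //; exact: mc.
by apply/funext => y; rewrite gibbsE.
Qed.

End gibbs_measurability.

(** The abstract bound is applied with psi = K h^s; [K] is meant to include the factor
    lambda^kappa. *)
Lemma expected_risk_le (R : realType) (q s b A lam K : R) (d : measure_display)
    (X : measurableType d) (P : probability (X * R)%type R)
    (G : {fset {mfun X >-> R}}) (n : nat) (dO : measure_display)
    (Omega : measurableType dO) (Pr : probability Omega R)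
    (Z : 'I_n -> {RV Pr >-> (X * R)%type}) (g : {mfun X >-> R}) :
  0 <= b -> 0 <= s -> 0 < lam -> 0 <= K ->
  (forall (rho : {mfun X >-> R} -> R) (x : X) (y : R),
    (forall g, g \in G -> 0 <= rho g) -> \sum_(g <- G) rho g = 1 ->
    fmean G rho (fun g => expR (- (lam * `|y - g x| `^ q))) <=
    expR (- (lam * `|y - fmean G rho (fun g => g x)| `^ q)) *
      expR (K * (`|y| + b) `^ s)) ->
  (\int[P]_z (`|z.2| `^ s)%:E <= A%:E)%E ->
  iid_from P Z -> g \in G ->
  (\int[Pr]_w ((n.+1%:R^-1)%:E *
     \sum_(i < n.+1) risk P q (gibbs_aggregate G q lam (fun j => Z j w) i)) <=
   risk P q g +
     (ln #|` G|%:R / (lam * n.+1%:R) + lam^-1 * (K * (2 `^ s * (A + b `^ s))))%:E)%E.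
Proof.
move=> b0 s0 lam0 K0 gap PA iidZ gG.
have G0 : G != fset0 by apply/fset0Pn; exists g.
pose ell (g : {mfun X >-> R}) z := Lq_loss q z g.
have mell h : measurable_fun setT (ell h) by exact: measurable_Lq_loss.
have mcumul i (h : {mfun X >-> R}) :
      measurable_fun setT (fun w => cumul_loss q (fun j => Z j w) i h).
  rewrite [X in measurable_fun _ X](_ : _ = fun w => \sum_(j < n)
      (if (j < i)%N then Lq_loss q (Z j w) h else 0)); last first.
    by apply/funext => w; rewrite /cumul_loss big_mkcond.
  apply: measurable_sum => j; have [ji|ji] := boolP (j < i)%N; last exact: measurable_cst.
  exact: (measurableT_comp (measurable_Lq_loss q h) (measurable_funPT (Z j))).
pose agg i w := gibbs_aggregate G q lam (fun j : 'I_n => Z j w) i.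
have magg i : measurable_fun setT (fun p : Omega * (X * R) => Lq_loss q p.2 (agg i p.1)).
  apply: (measurableT_comp (measurable_powR q)); apply: measurableT_comp => //.
  apply: measurable_funB; first exact: measurableT_comp measurable_snd measurable_snd.
  apply: (@measurable_fmean _ _ G _ (Omega * (X * R))%type
    (fun p => gibbs G (funif G) (fun g => lam * cumul_loss q (fun j => Z j p.1) i g))
    (fun p h => h p.2.1)).
    move=> h hG.
    apply: (@measurable_gibbs _ _ G lam G0 _ (Omega * (X * R))%type
      (fun p g => cumul_loss q (fun j => Z j p.1) i g)) => // k _.
    exact: measurableT_comp (mcumul i k) measurable_fst.
  move=> h _; apply: measurableT_comp => //.
  exact: measurableT_comp measurable_fst measurable_snd.
pose psi (z : X * R) := K * (`|z.2| + b) `^ s.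
have psi0 z : 0 <= psi z by rewrite mulr_ge0 ?powR_ge0.
have mpsi : measurable_fun setT psi.
  by apply: measurable_funM => //; exact: measurable_shifted_moment.
have mgap i w z : lam * Lq_loss q z (agg i w) +
    free_energy G lam (cumul_loss q (fun j => Z j w) i) <=
    free_energy G lam (fun g => cumul_loss q (fun j => Z j w) i g + ell g z) + psi z.
  set c := cumul_loss _ _ _.
  (* The gap is taken at the Gibbs weights; after logarithms, the exponential mean becomes a
     difference of free energies. *)
  have := gap (gibbs G (funif G) (fun g => lam * c g)) z.1 z.2
    (fun g _ => gibbs_ge0 lam G0 c g) (sum_gibbs lam G0 c).
  rewrite (fmean_gibbs_expR lam G0 c (fun g => Lq_loss q z g)) -expRD ler_expR.
  by rewrite /Lq_loss /agg /gibbs_aggregate /aggregate -/c /psi /ell /Lq_loss; lra.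
have := progressive_mixture_bound iidZ G0 lam0 (fun g z => Lq_loss_ge0 q z g) mell
  (fun i w z => Lq_loss_ge0 q z (agg i w)) magg psi0 mpsi mgap gG.
move/le_trans; apply; rewrite -addeA leeD2l// EFinD leeD2l//.
rewrite EFinM; apply: lee_wpmul2l; first by rewrite lee_fin invr_ge0 ltW.
rewrite /psi; under eq_integral do rewrite EFinM.
rewrite ge0_integralZl//.
- rewrite EFinM; apply: lee_wpmul2l; first by rewrite lee_fin.
  exact: shifted_moment_le.
- by apply/measurable_EFinP; exact: measurable_shifted_moment.
- by move=> z _; rewrite lee_fin powR_ge0.
Qed.

Lemma gibbs_aggregate_fset1 (R : realType) (d : measure_display) (X : measurableType d)
    (q lam : R) (n : nat) (z : 'I_n -> X * R) i (g : {mfun X >-> R}) :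
  gibbs_aggregate [fset g]%fset q lam z i = g.
Proof.
have G0 : [fset g]%fset != fset0 by apply/fset0Pn; exists g; rewrite inE.
apply/funext => x; rewrite /gibbs_aggregate /aggregate /fmean big_seq_fset1.
have := sum_gibbs lam G0 (cumul_loss q z i).
by rewrite big_seq_fset1 => ->; rewrite mul1r.
Qed.

Theorem corollary7p5 (R : realType) (q s b A C1 : R) :
  1 < q -> q <= s -> 0 < b -> 0 < A -> 0 < C1 ->
  exists C : R,
    forall (d : measure_display) (X : measurableType d)
      (P : probability (X * R)%type R) (G : {fset {mfun X >-> R}})
      (n : nat) (dO : measure_display) (Omega : measurableType dO)
      (Pr : probability Omega R) (Z : 'I_n -> {RV Pr >-> (X * R)%type}),
    (0 < n)%N ->
    G != fset0 ->
    (forall g : {mfun X >-> R}, g \in G -> forall x : X, `|g x| <= b) ->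
    (\int[P]_z (`|z.2| `^ s)%:E <= A%:E)%E ->
    iid_from P Z ->
    let r : R := ln #|` G|%:R / n%:R in
    let lambda : R := temperature C1 q s r in
    let expected_risk : \bar R :=
      (\int[Pr]_w ((n.+1%:R^-1)%:E *
         \sum_(i < n.+1)
           risk P q (gibbs_aggregate G q lambda (fun j => Z j w) i)))%E in
    let min_risk : \bar R := \big[mine/+oo%E]_(g <- G) risk P q g in
    (s <= 2 * q - 2 ->
       (expected_risk <= min_risk + (C * r `^ (1 - (q - 1) / s))%:E)%E) /\
    (2 * q - 2 <= s ->
       (expected_risk <= min_risk + (C * r `^ (1 - q / (s + 2)))%:E)%E).
Proof.
move=> q1 qs b0 A0 C10; have [K K0 gap] := Lq_mixture_gap q1 qs b0.
have k1 := rate_exp_gt1 q1 qs.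
set k := rate_exp q s in k1 gap; have k0 : 0 < k by exact: lt_trans k1.
pose H := 2 `^ s * (A + b `^ s).
have H0 : 0 <= H by rewrite mulr_ge0 ?powR_ge0// addr_ge0 ?powR_ge0// ltW.
(* The summands come from ln |G| / (lambda (n+1)) and from K H lambda^(kappa - 1), with lambda = C1
   r^(1/kappa). *)
pose C := C1^-1 + K * H * C1 `^ (k - 1).
have C0 : 0 <= C.
  by rewrite addr_ge0 ?invr_ge0 ?(ltW C10)// mulr_ge0 ?powR_ge0// mulr_ge0.
exists C => d X P G n dO Omega Pr Z n0 G0 Gb PA iidZ r lambda ER minR.
suff main : (ER <= minR + (C * r `^ (1 - k^-1))%:E)%E.
  split=> sq; first by rewrite rate_exp_le.
  by rewrite rate_exp_ge.
apply: le_bigmine => g gG.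
have [G1|G1] := leqP #|` G| 1.
  have GE : G = [fset g]%fset.
    apply/esym/eqP; rewrite eqEfcard fsub1set gG cardfs1.
    by rewrite (leq_trans G1).
  have -> : ER = risk P q g.
    have sumE : (\sum_(i < n.+1) risk P q g = n.+1%:R%:E * risk P q g)%E.
      by rewrite sumr_const card_ord mule_natl.
    rewrite /ER; under eq_integral => w _.
      under eq_bigr do rewrite {1}GE gibbs_aggregate_fset1.
      rewrite sumE muleA -EFinM mulVf ?pnatr_eq0// mul1e.
      over.
    by rewrite integral_cst//= probability_setT mule1.
  by rewrite leeDl// lee_fin mulr_ge0// powR_ge0.
have n0R : 0 < n%:R :> R by rewrite ltr0n.
have lnG : 0 < ln #|` G|%:R :> R by rewrite ln_gt0// ltr1n.
have r0 : 0 < r by rewrite divr_gt0.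
have lamE : lambda = C1 * r `^ k^-1 by rewrite /lambda temperatureE.
have lam0 : 0 < lambda by rewrite lamE mulr_gt0// powR_gt0.
have s0 : 0 <= s by lra.
have KL : 0 <= K * lambda `^ k by rewrite mulr_ge0 ?powR_ge0.
have B := @expected_risk_le R q s b A lambda (K * lambda `^ k) d X P G n dO Omega Pr Z g
  (ltW b0) s0 lam0 KL
  (fun rho x y rho0 rho1 => gap _ G rho lambda y (fun g => g x) rho0 rho1 (ltW lam0)
     (fun g gG => Gb g gG x)) PA iidZ gG.
apply: (le_trans B); rewrite leeD2l// lee_fin -/H /C mulrDl.
have rk : r `^ (1 - k^-1) = r / r `^ k^-1.
  by rewrite powRB ?powRr1 ?(ltW r0)// (gt_eqF r0) implybT.
apply: lerD.
  (* As r^(1 - 1/kappa) / C1 equals ln |G| / (lambda n), this amounts to n <= n + 1. *)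
  rewrite rk lamE ler_pdivrMr; last by rewrite mulr_gt0 -?lamE// ltr0n.
  rewrite [leRHS](_ : _ = ln #|` G|%:R * (n.+1%:R / n%:R)).
    rewrite ler_peMr ?(ltW lnG)// ler_pdivlMr// mul1r ler_nat//.
  rewrite /r; field.
  by rewrite !gt_eqF// powR_gt0.
have -> : lambda^-1 * (K * lambda `^ k * H) = K * H * (lambda `^ k / lambda) by ring.
have -> : lambda `^ k / lambda = lambda `^ (k - 1).
  by rewrite powRB ?powRr1 ?(ltW lam0)// (gt_eqF lam0) implybT.
rewrite lamE powRM ?powR_ge0 ?(ltW C10)// -powRrM.
have -> : k^-1 * (k - 1) = 1 - k^-1 by field; rewrite gt_eqF.
by rewrite !mulrA.
Qed.
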